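(* Let $M=0$, $\delta_2\in(0,8)$ and $\delta_1\in\mathbb{R}$. Then $G_{0,\delta_1,\delta_2}$ is negative on $[0,1]\times[0,1]$ (that is, $G_{0,\delta_1,\delta_2}(t,s)<0$ for all $(t,s)\in[0,1]\times[0,1]$) if and only if $$|\delta_1|<2-\frac{\delta_2}{4}.$$
   Context: Let $I=[0,1]$. For real parameters $M,\delta_1,\delta_2$ consider the problem $$u''(t)+M\,u(t)=\sigma(t),\ t\in I,\qquad u(0)-u(1)=\delta_1\int_0^1u(s)\,ds,\qquad u'(0)-u'(1)=\delta_2\int_0^1u(s)\,ds,$$ with $\sigma\in C(I)$. If this problem has a unique solution $u\in C^2(I)$ for every $\sigma\in C(I)$ (this happens exactly when $\delta_2\ne M$ and $M\neq 4k^2\pi^2$ for all integers $k\ge 1$), its Green's function $G_{M,\delta_1,\delta_2}$ is the unique continuous function on $I\times I$ such that for every $\sigma\in C(I)$ the unique solution is $u(t)=\int_0^1G_{M,\delta_1,\delta_2}(t,s)\,\sigma(s)\,ds$. Here $M=0$. *)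

(* Defs.v *)
From Stdlib Require Import Reals ClassicalEpsilon.
From Coquelicot Require Import Coquelicot.

Open Scope R_scope.

Definition I01 (t : R) : Prop := 0 <= t <= 1.

Definition continuous_on_square (G : R -> R -> R) : Prop :=
  continuous_on (fun p : R * R => I01 (fst p) /\ I01 (snd p))
                (fun p : R * R => G (fst p) (snd p)).

(* [D_in f f' I01 t] is differentiability of [f] at [t] relative to [0,1], with
   derivative [f' t]: one-sided at the endpoints. *)
Definition is_solution (M d1 d2 : R) (sigma u : R -> R) : Prop :=
  exists u' u'' : R -> R,
    (forall t, I01 t -> D_in u u' I01 t) /\
    (forall t, I01 t -> D_in u' u'' I01 t) /\
    continuous_on I01 u'' /\
    (forall t, I01 t -> u'' t + M * u t = sigma t) /\
    u 0 - u 1 = d1 * RInt u 0 1 /\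
    u' 0 - u' 1 = d2 * RInt u 0 1.

Definition green_op (G : R -> R -> R) (sigma : R -> R) (t : R) : R :=
  RInt (fun s => G t s * sigma s) 0 1.

(* Elements of C(I) and C(I x I) are represented by functions on the whole line
   or plane, of which only the restriction to [0,1] matters; hence equality of
   solutions is required on [0,1] only. *)
Definition is_green (M d1 d2 : R) (G : R -> R -> R) : Prop :=
  continuous_on_square G /\
  forall sigma : R -> R, continuous_on I01 sigma ->
    is_solution M d1 d2 sigma (green_op G sigma) /\
    (forall u, is_solution M d1 d2 sigma u ->
       forall t, I01 t -> u t = green_op G sigma t).

(* The function singled out by [is_green] (its values on the square are then
   unique); unspecified when the problem is not uniquely solvable. *)
Definition green (M d1 d2 : R) : R -> R -> R :=
  epsilon (inhabits (fun _ _ : R => 0)) (is_green M d1 d2).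

(* Main.v *)
Require Import Defs.
From Stdlib Require Import Reals ClassicalEpsilon Lra.
From Coquelicot Require Import Coquelicot.

Open Scope R_scope.

(** The Green's function can be computed in closed form.  Integrating
    [u'' = sigma] and using the second boundary condition gives
    [d2 * RInt u 0 1 = - RInt sigma 0 1]; this fixes the mean of [u], the first
    boundary condition then fixes its slope, and writing the resulting double
    primitive of [sigma] as a single integral yields, with [r = |t - s|],
    << G t s = - 1/d2 + (d1/d2) (t - 1/2) + r (1 - r)/2 - t (1 - t)/2. >>

    On the square, [r (1 - r)/2 <= 1/8], [- t (1 - t)/2 <= 0] and
    [(d1/d2) (t - 1/2) <= |d1|/(2 d2)] when [d2 > 0].  These three bounds are
    attained together, at [s = 1/2] and [t = 1] or [t = 0] according to the sign
    of [d1], so the maximum of [G] is [- 1/d2 + |d1|/(2 d2) + 1/8], which is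
    negative exactly when [|d1| < 2 - d2/4].

    As [green] is only specified by [is_green], two facts connect it with the
    formula: the formula satisfies [is_green] ([green_formula_is_green]), and
    [is_green] determines its values on the square ([is_green_unique]), because
    a continuous kernel whose difference with another is orthogonal to every
    continuous function vanishes. *)

(** * Continuous functions on the unit interval *)

(** The retraction of the line onto [0,1].  Composing with it turns a function
    continuous relative to [0,1] into a function continuous everywhere with the
    same values on [0,1], to which the two-sided theory of integration and
    differentiation applies. *)
Definition clamp (x : R) : R := Rmax 0 (Rmin 1 x).

Lemma clamp_in (x : R) : I01 (clamp x).
Proof.
  unfold I01, clamp, Rmax, Rmin.
  destruct (Rle_dec 1 x); destruct (Rle_dec 0 _); lra.
Qed.

Lemma clamp_id (x : R) : I01 x -> clamp x = x.
Proof.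
  unfold I01, clamp, Rmax, Rmin; intros H.
  destruct (Rle_dec 1 x); destruct (Rle_dec 0 _); lra.
Qed.

Lemma clamp_lipschitz (x y : R) : Rabs (clamp y - clamp x) <= Rabs (y - x).
Proof.
  unfold clamp, Rmax, Rmin.
  destruct (Rle_dec 1 x); destruct (Rle_dec 1 y);
    repeat destruct (Rle_dec 0 _);
    unfold Rabs; repeat destruct (Rcase_abs _); lra.
Qed.

Lemma continuous_clamp_comp (f : R -> R) :
  continuous_on I01 f -> forall x, continuous (fun y => f (clamp y)) x.
Proof.
  intros Hf x. unfold continuous.
  apply filterlim_comp with (G := within I01 (locally (clamp x))).
  - intros P [eps HP]. exists eps. intros y Hy.
    apply HP; [| apply clamp_in].
    unfold ball in *; simpl in *; unfold AbsRing_ball, minus, plus, opp in *;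
      simpl in *; unfold abs in *; simpl in *.
    apply Rle_lt_trans with (2 := Hy), clamp_lipschitz.
  - apply Hf, clamp_in.
Qed.

Lemma RInt_clamp (f : R -> R) (g : R -> R -> R) :
  RInt (fun s => g s (f (clamp s))) 0 1 = RInt (fun s => g s (f s)) 0 1.
Proof.
  apply RInt_ext. rewrite Rmin_left, Rmax_right by lra. intros s Hs.
  rewrite clamp_id; [reflexivity | unfold I01; lra].
Qed.

Lemma ex_RInt_continuous_on (f : R -> R) :
  continuous_on I01 f -> ex_RInt f 0 1.
Proof.
  intros Hf. apply ex_RInt_ext with (fun s => f (clamp s)).
  - rewrite Rmin_left, Rmax_right by lra. intros s Hs.
    rewrite clamp_id; [reflexivity | unfold I01; lra].
  - apply (ex_RInt_continuous (V := R_CompleteNormedModule)).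
    intros z _. now apply continuous_clamp_comp.
Qed.

Lemma continuous_on_I01_mult (f g : R -> R) :
  continuous_on I01 f -> continuous_on I01 g ->
  continuous_on I01 (fun s => f s * g s).
Proof.
  intros Hf Hg.
  apply continuous_on_ext with (fun s => f (clamp s) * g (clamp s)).
  - intros s Hs. now rewrite (clamp_id s Hs).
  - apply continuous_on_forall. intros s _.
    apply (continuous_mult (K := R_AbsRing)); now apply continuous_clamp_comp.
Qed.

Lemma continuous_on_I01_minus (f g : R -> R) :
  continuous_on I01 f -> continuous_on I01 g ->
  continuous_on I01 (fun s => f s - g s).
Proof.
  intros Hf Hg.
  apply continuous_on_ext with (fun s => f (clamp s) - g (clamp s)).
  - intros s Hs. now rewrite (clamp_id s Hs).
  - apply continuous_on_forall. intros s _.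
    apply (continuous_minus (V := R_NormedModule));
      now apply continuous_clamp_comp.
Qed.

Lemma continuous_on_square_section (G : R -> R -> R) (t : R) :
  continuous_on_square G -> I01 t -> continuous_on I01 (G t).
Proof.
  intros HG Ht s Hs.
  apply (filterlim_comp _ _ _ (fun y => (t, y)) (fun p => G (fst p) (snd p))
           _ (within (fun p => I01 (fst p) /\ I01 (snd p)) (locally (t, s)))).
  - intros P [eps HP]. exists eps. intros y Hy HIy.
    apply HP; [split; [apply ball_center | exact Hy] | now split].
  - exact (HG (t, s) (conj Ht Hs)).
Qed.

(** A positive value at one point, possibly an endpoint, forces positivity on a
    nondegenerate subinterval, and this contributes a positive amount. *)
Lemma RInt_nonneg_eq_0 (f : R -> R) :
  continuous_on I01 f -> (forall s, I01 s -> 0 <= f s) -> RInt f 0 1 = 0 ->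
  forall s, I01 s -> f s = 0.
Proof.
  intros Hf Hpos Hint s Hs.
  destruct (Rle_lt_or_eq_dec _ _ (Hpos s Hs)) as [Hlt | Heq]; [| now symmetry].
  exfalso.
  set (g := fun x => f (clamp x)).
  assert (Hg : forall x, continuous g x) by now apply continuous_clamp_comp.
  assert (Hg0 : forall x, 0 <= g x) by (intros x; apply Hpos, clamp_in).
  assert (Hgi : RInt g 0 1 = 0).
  { apply eq_trans with (2 := Hint). exact (RInt_clamp f (fun _ y => y)). }
  assert (Hgs : 0 < g s) by (unfold g; now rewrite clamp_id).
  assert (Hex : forall a b, ex_RInt g a b)
    by (intros a b; apply (ex_RInt_continuous (V := R_CompleteNormedModule));
        intros; apply Hg).
  destruct (Hg s (fun y => 0 < y)) as [eps Heps].
  { now apply open_gt. }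
  pose proof (cond_pos eps) as He. destruct Hs as [Hs0 Hs1].
  set (a := Rmax 0 (s - eps)). set (b := Rmin 1 (s + eps)).
  assert (Hab : 0 <= a <= s /\ s - eps <= a /\ s <= b <= 1 /\ b <= s + eps
                /\ a < b).
  { unfold a, b, Rmax, Rmin.
    destruct (Rle_dec 0 _); destruct (Rle_dec 1 _); lra. }
  assert (H1 : 0 < RInt g a b).
  { apply RInt_gt_0; [lra | | intros; apply Hg].
    intros x Hx. apply Heps.
    unfold ball; simpl; unfold AbsRing_ball, minus, plus, opp; simpl;
      unfold abs; simpl.
    apply Rabs_def1; lra. }
  assert (H2 : 0 <= RInt g 0 a) by (apply RInt_ge_0; [lra | apply Hex | auto]).
  assert (H3 : 0 <= RInt g b 1) by (apply RInt_ge_0; [lra | apply Hex | auto]).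
  pose proof (RInt_Chasles g 0 a b (Hex _ _) (Hex _ _)) as C1.
  pose proof (RInt_Chasles g 0 b 1 (Hex _ _) (Hex _ _)) as C2.
  unfold plus in C1, C2; simpl in C1, C2. lra.
Qed.

(** * Derivatives relative to the unit interval *)

Lemma is_derive_D_in (f f' : R -> R) (t : R) :
  is_derive f t (f' t) -> D_in f f' I01 t.
Proof.
  intros H. apply D_in_imp with no_cond; [easy |].
  now apply derivable_pt_lim_D_in, is_derive_Reals.
Qed.

Lemma D_in_I01_ext (f g f' : R -> R) (t : R) :
  (forall x, I01 x -> f x = g x) -> I01 t ->
  D_in f f' I01 t -> D_in g f' I01 t.
Proof.
  intros Hfg Ht H eps Heps. destruct (H eps Heps) as [alp [Halp Hd]].
  exists alp. split; [exact Halp |]. intros x Hx.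
  rewrite <- (Hfg t Ht), <- (Hfg x); [now apply Hd | apply Hx].
Qed.

Lemma D_in_I01_is_derive (f f' : R -> R) (t : R) :
  0 < t < 1 -> D_in f f' I01 t -> is_derive f t (f' t).
Proof.
  intros Ht H. apply is_derive_Reals. intros eps Heps.
  destruct (H eps Heps) as [alp [Halp Hd]].
  assert (Hdel : 0 < Rmin alp (Rmin t (1 - t)))
    by (repeat apply Rmin_pos; lra).
  exists (mkposreal _ Hdel). simpl. intros h Hh Hlt.
  pose proof (Rmin_l alp (Rmin t (1 - t))).
  pose proof (Rmin_r alp (Rmin t (1 - t))).
  pose proof (Rmin_l t (1 - t)). pose proof (Rmin_r t (1 - t)).
  assert (Hh' : Rabs h < t /\ Rabs h < 1 - t) by lra.
  destruct Hh' as [Hh1 Hh2].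
  apply Rabs_def2 in Hh1. apply Rabs_def2 in Hh2.
  specialize (Hd (t + h)). unfold D_x, I01 in Hd. simpl in Hd.
  unfold Rdist in Hd. replace (t + h - t) with h in Hd by ring.
  apply Hd. repeat split; lra.
Qed.

Lemma D_in_I01_continuous_on (f f' : R -> R) :
  (forall t, I01 t -> D_in f f' I01 t) -> continuous_on I01 f.
Proof.
  intros H t Ht. apply filterlim_locally. intros eps.
  destruct (cont_deriv f f' I01 t (H t Ht) eps (cond_pos eps))
    as [alp [Halp Hc]].
  exists (mkposreal alp Halp). intros y Hy HIy.
  destruct (Req_dec y t) as [-> | Hne]; [apply ball_center |].
  apply Hc. split; [split; [exact HIy | now apply not_eq_sym] | exact Hy].
Qed.

Lemma D_in_I01_zero_const (f f' : R -> R) :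
  (forall t, I01 t -> D_in f f' I01 t) -> (forall t, I01 t -> f' t = 0) ->
  forall t, I01 t -> f t = f 0.
Proof.
  intros H H0 t Ht.
  pose proof (continuous_clamp_comp f (D_in_I01_continuous_on f f' H)) as Hc.
  destruct Ht as [Ht0 Ht1].
  destruct (MVT_gen (fun x => f (clamp x)) 0 t (fun _ => 0)) as [c [_ Hmvt]].
  - rewrite Rmin_left, Rmax_right by lra. intros x Hx.
    apply is_derive_ext_loc with f.
    + apply locally_interval with (a := 0) (b := t); simpl; try lra.
      intros y Hy1 Hy2. rewrite clamp_id; [easy | unfold I01; simpl in *; lra].
    + rewrite <- (H0 x) by (unfold I01; lra).
      apply D_in_I01_is_derive; [lra | apply H; unfold I01; lra].
  - intros x _. apply continuity_pt_filterlim, Hc.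
  - rewrite !clamp_id in Hmvt by (unfold I01; lra). lra.
Qed.

(** * Uniqueness of the solution and of the Green's function *)

(** The difference of two solutions has zero second derivative, so it is affine;
    the second boundary condition gives it mean zero because [d2 <> 0], and then
    the first one gives it slope zero. *)
Lemma is_solution_0_unique (d1 d2 : R) (sigma u v : R -> R) :
  d2 <> 0 ->
  is_solution 0 d1 d2 sigma u -> is_solution 0 d1 d2 sigma v ->
  forall t, I01 t -> u t = v t.
Proof.
  intros Hd2 (u' & u'' & Du & Du' & _ & Eu & Bu & Bu')
    (v' & v'' & Dv & Dv' & _ & Ev & Bv & Bv').
  assert (I0 : I01 0) by (unfold I01; lra).
  assert (I1 : I01 1) by (unfold I01; lra).
  set (b := u' 0 - v' 0). set (a := u 0 - v 0).
  assert (Hslope : forall t, I01 t -> u' t - v' t = b).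
  { apply (D_in_I01_zero_const (fun t => u' t - v' t)
             (fun t => u'' t - v'' t)).
    - intros t Ht. now apply Dminus; [apply Du' | apply Dv'].
    - intros t Ht. specialize (Eu t Ht). specialize (Ev t Ht). lra. }
  assert (Haff : forall t, I01 t -> u t - v t - b * t = a).
  { intros t Ht.
    rewrite (D_in_I01_zero_const (fun t => u t - v t - b * t)
             (fun t => u' t - v' t - b * 1)) with (t := t); trivial.
    - unfold a; ring.
    - intros x Hx. apply Dminus; [apply Dminus; auto |].
      apply Dmult_const, Dx.
    - intros x Hx. rewrite (Hslope x Hx). ring. }
  assert (Hint : RInt u 0 1 - RInt v 0 1 = a + b / 2).
  { assert (Eu1 : ex_RInt u 0 1)
      by now apply ex_RInt_continuous_on, D_in_I01_continuous_on with u'.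
    assert (Ev1 : ex_RInt v 0 1)
      by now apply ex_RInt_continuous_on, D_in_I01_continuous_on with v'.
    change (minus (RInt u 0 1) (RInt v 0 1) = a + b / 2).
    rewrite <- RInt_minus by assumption.
    apply is_RInt_unique.
    apply is_RInt_ext with (fun t => a + b * t).
    - rewrite Rmin_left, Rmax_right by lra. intros t Ht.
      unfold minus, plus, opp; simpl.
      rewrite <- (Haff t) by (unfold I01; lra). ring.
    - set (P := fun t => a * t + b * t ^ 2 / 2).
      replace (a + b / 2) with (minus (P 1) (P 0))
        by (unfold P, minus, plus, opp; simpl; field).
      apply (is_RInt_derive (V := R_CompleteNormedModule)).
      + intros x _. unfold P. auto_derive; [easy | field].
      + intros x _. apply (ex_derive_continuous (V := R_NormedModule)).
        auto_derive; easy. }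
  pose proof (Hslope 1 I1) as S1. pose proof (Haff 1 I1) as A1.
  assert (Hmean : a + b / 2 = 0).
  { apply Rmult_eq_reg_l with d2; [| exact Hd2].
    rewrite <- Hint. unfold b in S1. lra. }
  assert (Hb : b = 0).
  { assert (E : RInt u 0 1 = RInt v 0 1) by lra.
    rewrite E in Bu. unfold a in A1. lra. }
  intros t Ht. specialize (Haff t Ht). rewrite Hb in *. lra.
Qed.

(** Two Green's functions [G] and [H] give the same solution for the datum
    [G t - H t], with [t] fixed; evaluating it at [t] says that the square of
    [G t - H t] has integral zero. *)
Lemma is_green_unique (M d1 d2 : R) (G H : R -> R -> R) :
  is_green M d1 d2 G -> is_green M d1 d2 H ->
  forall t s, I01 t -> I01 s -> G t s = H t s.
Proof.
  intros [CG SG] [CH SH] t s Ht Hs.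
  assert (CGt := continuous_on_square_section G t CG Ht).
  assert (CHt := continuous_on_square_section H t CH Ht).
  set (f := fun y => G t y - H t y).
  assert (Cf : continuous_on I01 f) by now apply continuous_on_I01_minus.
  assert (E : green_op G f t = green_op H f t).
  { apply (proj2 (SH f Cf)); [apply (SG f Cf) | exact Ht]. }
  assert (Z : f s * f s = 0).
  { apply (RInt_nonneg_eq_0 (fun y => f y * f y)); trivial.
    - now apply continuous_on_I01_mult.
    - intros y _. apply Rle_0_sqr.
    - rewrite (RInt_ext _ (fun y : R => minus (G := R_AbelianGroup)
                                           (G t y * f y) (H t y * f y))).
      + rewrite (RInt_minus (V := R_CompleteNormedModule));
          try now apply ex_RInt_continuous_on, continuous_on_I01_mult.
        unfold green_op in E. rewrite E.
        apply (minus_eq_zero (G := R_AbelianGroup)).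
      + intros y _. unfold minus, plus, opp, f; simpl. ring. }
  apply Rminus_diag_uniq. change (f s = 0).
  now destruct (Rmult_integral _ _ Z).
Qed.

(** * The explicit Green's function *)

Definition green_formula (d1 d2 t s : R) : R :=
  - 1 / d2 + d1 / d2 * (t - 1 / 2)
  + Rabs (t - s) * (1 - Rabs (t - s)) / 2 - t * (1 - t) / 2.

Lemma green_formula_continuous (d1 d2 : R) :
  continuous_on_square (green_formula d1 d2).
Proof.
  apply continuous_on_forall. intros [t s] _.
  set (abs_diff := fun p : R * R => Rabs (fst p - snd p)).
  assert (Hf : continuous (fun p : R * R => fst p) (t, s))
    by apply continuous_fst.
  assert (Ha : continuous abs_diff (t, s)).
  { apply (continuous_comp (fun p : R * R => fst p - snd p) Rabs).
    - apply (continuous_minus (V := R_NormedModule));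
        [apply continuous_fst | apply continuous_snd].
    - apply continuous_Rabs. }
  (* The formula is a polynomial in [t] plus one in [|t - s|]. *)
  set (p := fun x => - 1 / d2 + d1 / d2 * (x - 1 / 2) - x * (1 - x) / 2).
  set (q := fun x : R => x * (1 - x) / 2).
  apply continuous_ext with (fun z => plus (p (fst z)) (q (abs_diff z))).
  { intros z. unfold green_formula, p, q, abs_diff, plus; simpl.
    unfold Rdiv. ring. }
  apply (continuous_plus (V := R_NormedModule)).
  - apply (continuous_comp (fun z : R * R => fst z) p); [exact Hf |].
    apply (ex_derive_continuous (V := R_NormedModule)).
    unfold p. auto_derive; easy.
  - apply (continuous_comp abs_diff q); [exact Ha |].
    apply (ex_derive_continuous (V := R_NormedModule)).
    unfold q. auto_derive; easy.
Qed.

Definition moment (sigma : R -> R) (k : nat) (t : R) : R :=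
  RInt (fun s => s ^ k * sigma s) 0 t.

Lemma continuous_poly_mult (p sigma : R -> R) (t : R) :
  ex_derive p t -> continuous sigma t ->
  continuous (fun s => p s * sigma s) t.
Proof.
  intros Hp Hs. apply (continuous_mult (K := R_AbsRing)); [| exact Hs].
  now apply (ex_derive_continuous (V := R_NormedModule)).
Qed.

Lemma is_derive_moment (sigma : R -> R) (k : nat) (t : R) :
  (forall x, continuous sigma x) ->
  is_derive (moment sigma k) t (t ^ k * sigma t).
Proof.
  intros Hs.
  assert (Hc : forall x, continuous (fun s => s ^ k * sigma s) x).
  { intros x. apply continuous_poly_mult; [auto_derive; easy | apply Hs]. }
  apply (is_derive_RInt (V := R_NormedModule) (fun s => s ^ k * sigma s)
           (moment sigma k) 0 t); [| apply Hc].
  apply filter_forall. intros x.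
  apply (RInt_correct (V := R_CompleteNormedModule)), ex_RInt_continuous.
  intros; apply Hc.
Qed.

Lemma ex_derive_moment (sigma : R -> R) (k : nat) (t : R) :
  (forall x, continuous sigma x) -> ex_derive (fun x => moment sigma k x) t.
Proof. intros Hs. eexists. now apply is_derive_moment. Qed.

Lemma Derive_moment (sigma : R -> R) (k : nat) (t : R) :
  (forall x, continuous sigma x) ->
  Derive (fun x => moment sigma k x) t = t ^ k * sigma t.
Proof. intros Hs. now apply is_derive_unique, is_derive_moment. Qed.

Lemma moment_0 (sigma : R -> R) (k : nat) : moment sigma k 0 = 0.
Proof. apply (RInt_point (V := R_CompleteNormedModule)). Qed.

Lemma is_RInt_quadratic_mult (sigma : R -> R) (c0 c1 c2 a b : R) :
  (forall x, continuous sigma x) ->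
  is_RInt (fun s => (c0 + c1 * s + c2 * s ^ 2) * sigma s) a b
    (c0 * (moment sigma 0 b - moment sigma 0 a)
     + c1 * (moment sigma 1 b - moment sigma 1 a)
     + c2 * (moment sigma 2 b - moment sigma 2 a)).
Proof.
  intros Hs.
  set (P := fun x => c0 * moment sigma 0 x + c1 * moment sigma 1 x
                     + c2 * moment sigma 2 x).
  match goal with |- is_RInt _ _ _ ?v => replace v with (minus (P b) (P a)) end.
  2: unfold P, minus, plus, opp; simpl; ring.
  apply (is_RInt_derive (V := R_CompleteNormedModule)).
  - intros x _. unfold P.
    auto_derive.
    + repeat split; now apply ex_derive_moment.
    + rewrite !Derive_moment by exact Hs. ring.
  - intros x _. apply continuous_poly_mult; [auto_derive; easy | apply Hs].
Qed.

(** The term [t * moment sigma 0 t - moment sigma 1 t] is the double primitive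
    of [sigma], that is [RInt (fun s => (t - s) * sigma s) 0 t]; the affine part
    is the one dictated by the boundary conditions. *)
Definition solution_formula (d1 d2 : R) (sigma : R -> R) (t : R) : R :=
  (- 1 / d2 - d1 / (2 * d2)) * moment sigma 0 1
  + moment sigma 1 1 / 2 - moment sigma 2 1 / 2
  + t * ((d1 / d2 - 1) * moment sigma 0 1 + moment sigma 1 1)
  + t * moment sigma 0 t - moment sigma 1 t.

(** On either side of [s = t] the kernel is a quadratic polynomial in [s], so
    the integral is a combination of the moments of [sigma]. *)
Lemma green_op_formula (d1 d2 : R) (sigma : R -> R) (t : R) :
  d2 <> 0 -> (forall x, continuous sigma x) -> I01 t ->
  green_op (green_formula d1 d2) sigma t = solution_formula d1 d2 sigma t.
Proof.
  intros Hd2 Hs [Ht0 Ht1].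
  set (c := - 1 / d2 + d1 / d2 * (t - 1 / 2)).
  unfold green_op. apply is_RInt_unique.
  pose proof (is_RInt_quadratic_mult sigma c (t - 1 / 2) (- 1 / 2) 0 t Hs) as L.
  pose proof (is_RInt_quadratic_mult sigma (c - t) (t + 1 / 2) (- 1 / 2) t 1 Hs)
    as U.
  match type of L with is_RInt _ _ _ ?l =>
    match type of U with is_RInt _ _ _ ?r =>
      replace (solution_formula d1 d2 sigma t) with (plus l r) end end.
  2: { unfold solution_formula, c, plus; simpl. rewrite !moment_0. field.
       exact Hd2. }
  apply (is_RInt_Chasles (V := R_NormedModule)) with t.
  - apply (is_RInt_ext (V := R_NormedModule)) with (2 := L).
    rewrite Rmin_left, Rmax_right by lra. intros s Hst.
    match goal with |- ?x = ?y => change (@eq R x y) end.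
    unfold green_formula, c. rewrite Rabs_pos_eq by lra. field. exact Hd2.
  - apply (is_RInt_ext (V := R_NormedModule)) with (2 := U).
    rewrite Rmin_left, Rmax_right by lra. intros s Hst.
    match goal with |- ?x = ?y => change (@eq R x y) end.
    unfold green_formula, c. rewrite Rabs_left1 by lra. field. exact Hd2.
Qed.

Lemma is_derive_solution_formula (d1 d2 : R) (sigma : R -> R) (t : R) :
  (forall x, continuous sigma x) ->
  is_derive (solution_formula d1 d2 sigma) t
    ((d1 / d2 - 1) * moment sigma 0 1 + moment sigma 1 1 + moment sigma 0 t).
Proof.
  intros Hs.
  unfold solution_formula. auto_derive.
  - repeat split; now apply ex_derive_moment.
  - rewrite !Derive_moment by exact Hs. ring.
Qed.

(** In a primitive of the solution, the double primitive of [sigma] is replaced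
    by its triple primitive [t^2/2 m0 - t m1 + m2/2], where [mk] stands for
    [moment sigma k t]. *)
Lemma RInt_solution_formula (d1 d2 : R) (sigma : R -> R) :
  d2 <> 0 -> (forall x, continuous sigma x) ->
  RInt (solution_formula d1 d2 sigma) 0 1 = - moment sigma 0 1 / d2.
Proof.
  intros Hd2 Hs. apply is_RInt_unique.
  set (a := (- 1 / d2 - d1 / (2 * d2)) * moment sigma 0 1
            + moment sigma 1 1 / 2 - moment sigma 2 1 / 2).
  set (b := (d1 / d2 - 1) * moment sigma 0 1 + moment sigma 1 1).
  set (P := fun t => a * t + b * t ^ 2 / 2 + t ^ 2 / 2 * moment sigma 0 t
                     - t * moment sigma 1 t + moment sigma 2 t / 2).
  replace (- moment sigma 0 1 / d2) with (minus (P 1) (P 0)).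
  2: { unfold P, a, b, minus, plus, opp; simpl. rewrite !moment_0. field.
       exact Hd2. }
  apply (is_RInt_derive (V := R_CompleteNormedModule)).
  - intros t _.
    unfold P. auto_derive.
    + repeat split; now apply ex_derive_moment.
    + rewrite !Derive_moment by exact Hs.
      unfold solution_formula. fold a b. field.
  - intros t _. apply (ex_derive_continuous (V := R_NormedModule)).
    eexists. now apply is_derive_solution_formula.
Qed.

Lemma green_op_solution (d1 d2 : R) (sigma : R -> R) :
  d2 <> 0 -> continuous_on I01 sigma ->
  is_solution 0 d1 d2 sigma (green_op (green_formula d1 d2) sigma).
Proof.
  intros Hd2 Hc.
  set (sg := fun s => sigma (clamp s)).
  assert (Hs : forall x, continuous sg x) by now apply continuous_clamp_comp.
  assert (E : forall t, I01 t ->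
    solution_formula d1 d2 sg t = green_op (green_formula d1 d2) sigma t).
  { intros t Ht. rewrite <- green_op_formula by assumption.
    apply (RInt_clamp sigma (fun s y => green_formula d1 d2 t s * y)). }
  assert (I0 : I01 0) by (unfold I01; lra).
  assert (I1 : I01 1) by (unfold I01; lra).
  assert (EI : RInt (green_op (green_formula d1 d2) sigma) 0 1
               = - moment sg 0 1 / d2).
  { rewrite <- (RInt_solution_formula d1 d2 sg) by assumption.
    apply RInt_ext. rewrite Rmin_left, Rmax_right by lra. intros t Ht.
    symmetry. apply E. unfold I01; lra. }
  set (u' := fun t => (d1 / d2 - 1) * moment sg 0 1 + moment sg 1 1
                      + moment sg 0 t).
  exists u', sigma. repeat split.
  - intros t Ht. apply D_in_I01_ext with (1 := E); [exact Ht |].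
    apply is_derive_D_in. now apply is_derive_solution_formula.
  - intros t Ht. apply is_derive_D_in.
    unfold u'. auto_derive; [now apply ex_derive_moment |].
    rewrite !Derive_moment by exact Hs. unfold sg.
    rewrite (clamp_id t Ht). ring.
  - exact Hc.
  - intros t _. ring.
  - rewrite EI, <- (E 0 I0), <- (E 1 I1). unfold solution_formula.
    rewrite !moment_0. field. exact Hd2.
  - rewrite EI. unfold u'. rewrite !moment_0. field. exact Hd2.
Qed.

Lemma green_formula_is_green (d1 d2 : R) :
  d2 <> 0 -> is_green 0 d1 d2 (green_formula d1 d2).
Proof.
  intros Hd2. split; [apply green_formula_continuous |].
  intros sigma Hs. pose proof (green_op_solution d1 d2 sigma Hd2 Hs) as Hsol.
  split; [exact Hsol |].
  intros u Hu. now apply is_solution_0_unique with d1 d2 sigma.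
Qed.

Lemma green_0_eq (d1 d2 t s : R) :
  d2 <> 0 -> I01 t -> I01 s -> green 0 d1 d2 t s = green_formula d1 d2 t s.
Proof.
  intros Hd2.
  pose proof (green_formula_is_green d1 d2 Hd2) as HG.
  apply (is_green_unique 0 d1 d2); [| exact HG].
  unfold green. apply epsilon_spec. now exists (green_formula d1 d2).
Qed.

(** * The sign of the Green's function *)

(** The three terms of the formula that depend on [t] and [s] are bounded
    separately; nothing is lost, as equality holds at [s = 1/2] and one of
    [t = 0], [t = 1]. *)
Lemma green_formula_le (d1 d2 t s : R) :
  0 < d2 -> I01 t ->
  green_formula d1 d2 t s <= - 1 / d2 + Rabs d1 / d2 * (1 / 2) + 1 / 8.
Proof.
  intros Hd2 [Ht0 Ht1]. unfold green_formula.
  set (r := Rabs (t - s)).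
  assert (H1 : r * (1 - r) / 2 <= 1 / 8)
    by (pose proof (Rle_0_sqr (r - 1 / 2)); unfold Rsqr in *; lra).
  assert (H2 : 0 <= t * (1 - t)) by (apply Rmult_le_pos; lra).
  assert (H3 : d1 / d2 * (t - 1 / 2) <= Rabs d1 / d2 * (1 / 2)).
  { apply Rle_trans with (1 := Rle_abs _).
    unfold Rdiv at 1. rewrite !Rabs_mult, Rabs_inv, (Rabs_pos_eq d2) by lra.
    apply Rmult_le_compat_l.
    - apply Rmult_le_pos; [apply Rabs_pos |].
      now apply Rlt_le, Rinv_0_lt_compat.
    - apply Rabs_le; lra. }
  lra.
Qed.

Lemma green_formula_mid (d1 d2 t : R) :
  t = 0 \/ t = 1 ->
  green_formula d1 d2 t (1 / 2) = - 1 / d2 + d1 / d2 * (t - 1 / 2) + 1 / 8.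
Proof.
  unfold green_formula. intros [-> | ->].
  - rewrite Rabs_left by lra. lra.
  - rewrite Rabs_pos_eq by lra. lra.
Qed.

Theorem theorem5p5 (d1 d2 : R) (hd2 : 0 < d2 < 8) :
  (forall t s : R, 0 <= t <= 1 -> 0 <= s <= 1 -> green 0 d1 d2 t s < 0)
  <-> Rabs d1 < 2 - d2 / 4.
Proof.
  assert (Hne : d2 <> 0) by lra.
  assert (Hmax : - 1 / d2 + Rabs d1 / d2 * (1 / 2) + 1 / 8
                 = (Rabs d1 - (2 - d2 / 4)) * / (2 * d2)) by (field; lra).
  assert (Hpos : 0 < / (2 * d2)) by (apply Rinv_0_lt_compat; lra).
  split.
  - intros Hneg.
    assert (H : - 1 / d2 + Rabs d1 / d2 * (1 / 2) + 1 / 8 < 0).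
    { assert (Hend : forall t, t = 0 \/ t = 1 ->
                - 1 / d2 + d1 / d2 * (t - 1 / 2) + 1 / 8 < 0).
      { intros t Ht. rewrite <- green_formula_mid by assumption.
        rewrite <- green_0_eq; [apply Hneg | ..]; unfold I01; lra. }
      pose proof (Hend 0 (or_introl eq_refl)).
      pose proof (Hend 1 (or_intror eq_refl)).
      unfold Rabs, Rdiv in *. destruct (Rcase_abs d1); lra. }
    rewrite Hmax in H.
    destruct (Rlt_le_dec (Rabs d1) (2 - d2 / 4)) as [Hlt | Hge]; [exact Hlt |].
    assert (0 <= (Rabs d1 - (2 - d2 / 4)) * / (2 * d2))
      by (apply Rmult_le_pos; lra).
    lra.
  - intros H t s Ht Hs. rewrite green_0_eq by assumption.
    apply Rle_lt_trans with (1 := green_formula_le d1 d2 t s (proj1 hd2) Ht).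
    rewrite Hmax.
    rewrite <- (Rmult_0_l (/ (2 * d2))). apply Rmult_lt_compat_r; lra.
Qed.
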